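(* For any directed acyclic graph $D$ on $n\ge 1$ vertices, $F(D)=n-1$.
   Context: A finite simple digraph $D=(V,A)$ has finite nonempty vertex set $V$ and arc set $A$ consisting of ordered pairs of distinct vertices (no loops, no parallel arcs; both $(u,v)$ and $(v,u)$ may be present). $N_D^+(v)=\{u:(v,u)\in A\}$. A directed acyclic graph is a finite simple digraph containing no directed cycle (a closed directed walk $v_1\to v_2\to\cdots\to v_k\to v_1$ through $k\ge 2$ distinct vertices). Zero forcing: for $S\subseteq V$ let $B^0(S)=S$ and $B^{i+1}(S)=B^i(S)\cup\{w:\{w\}=N_D^+(v)\setminus B^i(S)\text{ for some }v\in B^i(S)\}$. $S$ is a zero forcing set (ZFS) if $B^t(S)=V$ for some $t\ge 0$, and a failed zero forcing set (FZFS) otherwise. The failed zero forcing number $F(D)$ is the largest cardinality of an FZFS of $D$. *)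

(* Defs.v *)
From mathcomp Require Import all_boot.
From mathcomp Require Import boolp.

Set Implicit Arguments.
Unset Strict Implicit.
Unset Printing Implicit Defensive.

Record digraph := Digraph {
  vertex :> finType;
  arc : rel vertex;
  arc_irrefl : irreflexive arc;
  vertex_gt0 : 0 < #|vertex|
}.

Arguments arc {d} u v.

Definition out_nbhd (D : digraph) (v : D) : {set D} := [set u | arc v u].

(* [ucycle] asks that the listed vertices be distinct and that each arc of the
   closed walk, including the one from the last vertex to the first, exist. *)
Definition acyclic (D : digraph) : Prop :=
  ~ exists c : seq D, 2 <= size c /\ ucycle arc c.

Definition force (D : digraph) (B : {set D}) : {set D} :=
  B :|: [set w | [exists v in B, out_nbhd v :\: B == [set w]]].

Definition forced (D : digraph) (i : nat) (S : {set D}) : {set D} :=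
  iter i (@force D) S.

Definition zero_forcing_set (D : digraph) (S : {set D}) : Prop :=
  exists t : nat, forced t S = [set: D].

Definition failed_zero_forcing_set (D : digraph) (S : {set D}) : Prop :=
  ~ zero_forcing_set S.

(* The default value 0 of an empty maximum plays no role: as the vertex set is
   nonempty, the empty set is always a failed zero forcing set. *)
Definition failed_zero_forcing_number (D : digraph) : nat :=
  \max_(S : {set D} | `[< failed_zero_forcing_set S >]) #|S|.

(* Main.v *)
(* A finite acyclic digraph has a source [s], since iterating a choice of
   in-neighbours would otherwise run into a directed cycle. No vertex ever
   forces [s], so the complement of [s] is stalled and fails. *)
From mathcomp Require Import all_boot.
From mathcomp Require Import boolp.
Require Import Defs.

Set Implicit Arguments.
Unset Strict Implicit.
Unset Printing Implicit Defensive.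

(** By finiteness the iterate of index [order f x] repeats an earlier one, of index [i]; the period
    found is the positive gap [order f x - i]. *)
Lemma iter_periodic_point (T : finType) (f : T -> T) (x : T) :
  exists m k, iter k.+1 f (iter m f x) = iter m f x.
Proof.
have /trajectP[i lt_i Ei] : looping f x (order f x) by apply: looping_order.
exists i, (order f x - i.+1).
by rewrite -iterD addSnnS subnK.
Qed.

Lemma acyclic_source (D : digraph) :
  acyclic D -> exists s : D, forall v, ~~ arc v s.
Proof.
move=> acD.
suff /existsP[s /forallP sP] : [exists s : D, [forall v : D, ~~ arc v s]].
  by exists s.
apply: contra_notT acD.
rewrite negb_exists => /forallP noS.
have pP (s : D) : exists v : D, arc v s.
  by have := noS s; rewrite negb_forall => /existsP[v /negPn]; exists v.
pose p (s : D) := xchoose (pP s).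
have arc_p s : arc (p s) s by apply: (xchooseP (pP s)).
have /card_gt0P[x _] := vertex_gt0 D.
have [m [k]] := iter_periodic_point p x.
set y := iter m p x => Ey.
(* Indices 0 and 3 select two equivalent conditions: the orbit is a cycle, and some positive iterate
   fixes [y]. *)
have cyc : fcycle p (orbit p y) by apply/(orbitPcycle 0 3); exists k.
(* An orbit of size one would make [y] a fixed point of [p], hence give a loop at [y]. *)
have le2 : 1 < size (orbit p y).
  rewrite size_orbit ltn_neqAle order_gt0 andbT; apply/eqP => o1.
  move: cyc; rewrite /orbit -o1 /= andbT => /eqP py.
  by have := arc_p y; rewrite py arc_irrefl.
(* Since [p] steps to an in-neighbour, the arcs run backwards along the orbit, hence the
   reversal. *)
exists (rev (orbit p y)); rewrite size_rev; split=> //.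
rewrite /ucycle rev_cycle rev_uniq orbit_uniq andbT.
by apply: sub_cycle cyc => u v /eqP <-; apply: arc_p.
Qed.

Lemma forced_setC1_source (D : digraph) (s : D) (t : nat) :
  (forall v, ~~ arc v s) -> forced t [set~ s] = [set~ s].
Proof.
move=> src; elim: t => //= t ->; apply/setUidPl/subsetP => w.
rewrite !inE => /exists_inP[v _ /eqP/setP/(_ w)].
rewrite !inE eqxx => /andP[_ vw].
by apply: contraTneq vw => ->; apply: src.
Qed.

Theorem proposition4p2 (n : nat) (hn : 1 <= n) (D : digraph)
  (hD : #|D| = n) (acyclicD : acyclic D) :
  failed_zero_forcing_number D = n - 1.
Proof.
have [s src] := acyclic_source acyclicD.
apply/eqP; rewrite eqn_leq; apply/andP; split.
  (* Upper bound: a set of at least [n] vertices is the whole vertex set, which is zero forcing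
     already at time 0. *)
  apply/bigmax_leqP => S /asboolP failS.
  rewrite -ltnS subn1 prednK // -hD -cardsT ltnNge.
  apply/negP => leS; apply: failS; exists 0.
  by apply/eqP; rewrite eqEcard subsetT.
have <- : #|[set~ s]| = n - 1 by rewrite cardsC1 hD subn1.
apply: leq_bigmax_cond; apply/asboolP => -[t].
rewrite (forced_setC1_source t src) => /setP/(_ s).
by rewrite !inE eqxx.
Qed.
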